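(* If a full tripos $P\colon \mathcal{C}^{\mathrm{op}}\to \mathsf{InfSl}$ is $\exists$-supercompactifiable, then for every object $X$ of $\mathcal{C}$ the slice doctrine $P_{/X}\colon (\mathcal{C}/X)^{\mathrm{op}}\to\mathsf{InfSl}$ is an $\exists$-supercompactifiable full tripos.
   Context: A lex primary doctrine is a functor $P\colon \mathcal{C}^{\mathrm{op}}\to\mathsf{InfSl}$, where $\mathcal{C}$ has finite limits and $\mathsf{InfSl}$ is the category of inf-semilattices (posets with finite meets, including top) and their homomorphisms. For $f\colon A\to B$ write $P_f\colon P(B)\to P(A)$. Slice doctrine: for an object $X$ of $\mathcal{C}$, $P_{/X}\colon(\mathcal{C}/X)^{\mathrm{op}}\to\mathsf{InfSl}$ is given by $P_{/X}(Y\xrightarrow{f}X):=P(Y)$ and, for an arrow $h\colon g\to f$ of $\mathcal{C}/X$, $(P_{/X})_h:=P_h$. $P$ is full existential if for every arrow $f$ of $\mathcal{C}$ the map $P_f$ has a left adjoint $\exists_f$, satisfying Beck–Chevalley (for pullback squares) and Frobenius reciprocity. $P$ is a full first-order hyperdoctrine if it is full existential, each $P(A)$ is a Heyting algebra, each $P_f$ is a Heyting algebra homomorphism, and each $P_f$ also has a right adjoint $\forall_f$, these satisfying Beck–Chevalley. $P$ has weak power objects if for every object $X$ there are an object $\mathrm{P}X$ and an element $\in_X\in P(X\times\mathrm{P}X)$ such that for every object $Y$ and $\beta\in P(X\times Y)$ there is an arrow $\{\beta\}_X\colon Y\to\mathrm{P}X$ with $\beta=P_{\mathrm{id}_X\times\{\beta\}_X}(\in_X)$.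 A full tripos is a full first-order hyperdoctrine with weak power objects. Category of points $\mathcal{G}_P$: objects are pairs $(A,\alpha)$ with $\alpha\in P(A)$; arrows $(A,\alpha)\to(B,\beta)$ are arrows $f\colon A\to B$ of $\mathcal{C}$ with $\alpha\le P_f(\beta)$. It has finite limits. Weak dependent products: a weak dependent product of $f\colon X\to J$ along $g\colon J\to I$ consists of an arrow $h\colon Z\to I$ and an arrow $e\colon E\to X$, where $E$ is the pullback of $g$ and $h$, such that $fe$ is the projection $E\to J$, and such that for any other such data $h'\colon Z'\to I$, $e'\colon E'\to X$ (with $E'$ the pullback of $g$ and $h'$, and $fe'$ the projection $E'\to J$) there is $w\colon Z'\to Z$ with $h'=hw$ and $e'=ek$, where $k\colon E'\to E$ is induced by $w$. A category has weak dependent products if these exist for all such $f,g$. Generic proof: an arrow $\theta\colon\Theta\to\Lambda$ such that for every arrow $f\colon Y\to X$ there is $\upsilon_f\colon X\to\Lambda$ such that $f$ factors through the pullback $\upsilon_f^*\theta$ of $\theta$ along $\upsilon_f$ and $\upsilon_f^*\theta$ factors through $f$. A lex primary doctrine $P$ is $\exists$-supercompactifiable if $\mathcal{G}_P$ has weak dependent products and a generic proof. *)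

(* Defs.v *)
From Stdlib Require Import FinFun ProofIrrelevance.

Set Implicit Arguments.
Unset Strict Implicit.
Unset Printing Implicit Defensive.

Declare Scope cat_scope.
Delimit Scope cat_scope with cat.
Local Open Scope cat_scope.

Record Category := {
  Ob :> Type;
  Hom : Ob -> Ob -> Type;
  idm : forall A, Hom A A;
  comp : forall A B C, Hom B C -> Hom A B -> Hom A C;
  comp_idl : forall A B (f : Hom A B), comp (idm B) f = f;
  comp_idr : forall A B (f : Hom A B), comp f (idm A) = f;
  comp_assoc : forall A B C D (h : Hom C D) (g : Hom B C) (f : Hom A B),
    comp h (comp g f) = comp (comp h g) f
}.
Arguments Hom {c} _ _.
Arguments idm {c} A.

Notation "g ∘ f" := (comp g f) (at level 40, left associativity) : cat_scope.

Record Functor (J C : Category) := {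
  fobj :> J -> C;
  fmap : forall a b, Hom a b -> Hom (fobj a) (fobj b);
  fmap_id : forall a, fmap (idm a) = idm (fobj a);
  fmap_comp : forall a b c (g : Hom b c) (f : Hom a b),
    fmap (g ∘ f) = fmap g ∘ fmap f
}.

Definition finite_category (J : Category) : Prop :=
  Finite J /\ forall a b : J, Finite (Hom a b).

Section Limits.
Variable C : Category.

Definition is_cone (J : Category) (F : Functor J C) (L : C)
    (p : forall a, Hom L (F a)) : Prop :=
  forall a b (u : Hom a b), fmap F u ∘ p a = p b.

Definition is_limit (J : Category) (F : Functor J C) (L : C)
    (p : forall a, Hom L (F a)) : Prop :=
  is_cone p /\
  forall (M : C) (q : forall a, Hom M (F a)), is_cone q ->
    exists! m : Hom M L, forall a, p a ∘ m = q a.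

Definition has_finite_limits : Prop :=
  forall J : Category, finite_category J ->
  forall F : Functor J C,
  exists (L : C) (p : forall a, Hom L (F a)), is_limit p.

Definition is_product (A B W : C) (p : Hom W A) (q : Hom W B) : Prop :=
  forall (V : C) (a : Hom V A) (b : Hom V B),
    exists! m : Hom V W, p ∘ m = a /\ q ∘ m = b.

(* D --q--> B
   |p       |g
   A --f--> I   *)
Definition is_pullback (A B I D : C) (f : Hom A I) (g : Hom B I)
    (p : Hom D A) (q : Hom D B) : Prop :=
  f ∘ p = g ∘ q /\
  forall (V : C) (a : Hom V A) (b : Hom V B), f ∘ a = g ∘ b ->
    exists! m : Hom V D, p ∘ m = a /\ q ∘ m = b.

(* E --q--> Z
   |p       |h      with e : E -> X and f ∘ e = p
   J --g--> I   *)
Definition dependent_product_data (X J I : C) (f : Hom X J) (g : Hom J I)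
    (Z E : C) (h : Hom Z I) (p : Hom E J) (q : Hom E Z) (e : Hom E X) : Prop :=
  is_pullback g h p q /\ f ∘ e = p.

Definition is_weak_dependent_product (X J I : C) (f : Hom X J) (g : Hom J I)
    (Z E : C) (h : Hom Z I) (p : Hom E J) (q : Hom E Z) (e : Hom E X) : Prop :=
  dependent_product_data f g h p q e /\
  forall (Z' E' : C) (h' : Hom Z' I) (p' : Hom E' J) (q' : Hom E' Z')
         (e' : Hom E' X),
    dependent_product_data f g h' p' q' e' ->
    exists w : Hom Z' Z, h' = h ∘ w /\
    exists k : Hom E' E, (p ∘ k = p' /\ q ∘ k = w ∘ q') /\ e' = e ∘ k.

Definition has_weak_dependent_products : Prop :=
  forall (X J I : C) (f : Hom X J) (g : Hom J I),
  exists (Z E : C) (h : Hom Z I) (p : Hom E J) (q : Hom E Z) (e : Hom E X),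
    is_weak_dependent_product f g h p q e.

Definition factors_through (A B X : C) (f : Hom A X) (g : Hom B X) : Prop :=
  exists t : Hom A B, f = g ∘ t.

Definition is_generic_proof (T L : C) (theta : Hom T L) : Prop :=
  forall (Y X : C) (f : Hom Y X),
  exists (u : Hom X L) (W : C) (p : Hom W X) (q : Hom W T),
    is_pullback u theta p q /\ factors_through f p /\ factors_through p f.

Definition has_generic_proof : Prop :=
  exists (T L : C) (theta : Hom T L), is_generic_proof theta.

End Limits.

Section Slice.
Variables (C : Category) (X : C).

Record SliceOb := { slice_dom : C; slice_map : Hom slice_dom X }.

Definition SliceHom (g f : SliceOb) : Type :=
  { h : Hom (slice_dom g) (slice_dom f) | slice_map f ∘ h = slice_map g }.

Definition slice_id (f : SliceOb) : SliceHom f f :=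
  exist _ (idm (slice_dom f)) (comp_idr (slice_map f)).

Lemma slice_comp_proof (e f g : SliceOb) (k : SliceHom f g) (h : SliceHom e f) :
  slice_map g ∘ (proj1_sig k ∘ proj1_sig h) = slice_map e.
Proof. now rewrite comp_assoc, (proj2_sig k), (proj2_sig h). Qed.

Definition slice_comp (e f g : SliceOb) (k : SliceHom f g) (h : SliceHom e f) :
  SliceHom e g := exist _ (proj1_sig k ∘ proj1_sig h) (slice_comp_proof k h).

Definition slice : Category.
Proof.
refine {| Ob := SliceOb; Hom := SliceHom; idm := slice_id; comp := slice_comp |};
  [ intros A B [f Hf] | intros A B [f Hf] | intros A B D E h g f ];
  apply subset_eq_compat; simpl.
- apply comp_idl.
- apply comp_idr.
- apply comp_assoc.
Defined.

End Slice.

Record InfSl := {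
  carrier :> Type;
  le : carrier -> carrier -> Prop;
  meet : carrier -> carrier -> carrier;
  top : carrier;
  le_refl : forall x, le x x;
  le_trans : forall x y z, le x y -> le y z -> le x z;
  le_antisym : forall x y, le x y -> le y x -> x = y;
  le_top : forall x, le x top;
  le_meet : forall x y z, le z (meet x y) <-> le z x /\ le z y
}.
Arguments top {i}.

Notation "x ⊑ y" := (le x y) (at level 70, no associativity) : cat_scope.
Notation "x ⊓ y" := (meet x y) (at level 40, left associativity) : cat_scope.

Section Heyting.
Variable L : InfSl.

Definition is_bottom (b : L) : Prop := forall x : L, b ⊑ x.
Definition is_join (x y j : L) : Prop :=
  forall z : L, j ⊑ z <-> x ⊑ z /\ y ⊑ z.
Definition is_implication (x y i : L) : Prop :=
  forall z : L, z ⊑ i <-> z ⊓ x ⊑ y.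

Definition is_heyting_algebra : Prop :=
  (exists b, is_bottom b) /\
  (forall x y, exists j, is_join x y j) /\
  (forall x y, exists i, is_implication x y i).

End Heyting.

(* The operations are unique when they exist, so preservation can be stated
   relationally. *)
Definition is_heyting_hom (L M : InfSl) (h : L -> M) : Prop :=
  h top = top /\
  (forall x y, h (x ⊓ y) = h x ⊓ h y) /\
  (forall b, is_bottom b -> is_bottom (h b)) /\
  (forall x y j, is_join x y j -> is_join (h x) (h y) (h j)) /\
  (forall x y i, is_implication x y i -> is_implication (h x) (h y) (h i)).

Record Doctrine (C : Category) := {
  fib :> C -> InfSl;
  reindex : forall A B : C, Hom A B -> fib B -> fib A;
  reindex_top : forall A B (f : Hom A B), reindex f top = top;
  reindex_meet : forall A B (f : Hom A B) (x y : fib B),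
    reindex f (x ⊓ y) = reindex f x ⊓ reindex f y;
  reindex_id : forall A (x : fib A), reindex (idm A) x = x;
  reindex_comp : forall A B D (g : Hom B D) (f : Hom A B) (x : fib D),
    reindex (g ∘ f) x = reindex f (reindex g x)
}.

Definition slice_doctrine (C : Category) (P : Doctrine C) (X : C) :
  Doctrine (slice X).
Proof.
refine {| fib := fun f : slice X => P (slice_dom f);
          reindex := fun (g f : slice X) (h : Hom g f) =>
                       reindex (d := P) (proj1_sig h) |}; simpl; intros.
- apply reindex_top.
- apply reindex_meet.
- apply reindex_id.
- apply reindex_comp.
Defined.

Section DoctrineProperties.
Variables (C : Category) (P : Doctrine C).

Definition is_left_adjoint (A B : C) (f : Hom A B) (ex : P A -> P B) : Prop :=
  forall (x : P A) (y : P B), ex x ⊑ y <-> x ⊑ reindex f y.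

Definition is_right_adjoint (A B : C) (f : Hom A B) (all : P A -> P B) : Prop :=
  forall (x : P A) (y : P B), y ⊑ all x <-> reindex f y ⊑ x.

Definition beck_chevalley (Q : forall A B : C, Hom A B -> P A -> P B) : Prop :=
  forall (A B I D : C) (f : Hom A I) (g : Hom B I) (p : Hom D A) (q : Hom D B),
    is_pullback f g p q ->
    forall x : P A, reindex g (Q _ _ f x) = Q _ _ q (reindex p x).

Definition frobenius (Q : forall A B : C, Hom A B -> P A -> P B) : Prop :=
  forall (A B : C) (f : Hom A B) (x : P A) (y : P B),
    Q _ _ f (x ⊓ reindex f y) = Q _ _ f x ⊓ y.

Definition is_full_existential : Prop :=
  exists ex : forall A B : C, Hom A B -> P A -> P B,
    (forall A B (f : Hom A B), is_left_adjoint f (ex _ _ f)) /\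
    beck_chevalley ex /\ frobenius ex.

Definition is_full_universal : Prop :=
  exists all : forall A B : C, Hom A B -> P A -> P B,
    (forall A B (f : Hom A B), is_right_adjoint f (all _ _ f)) /\
    beck_chevalley all.

Definition is_full_first_order_hyperdoctrine : Prop :=
  is_full_existential /\
  (forall A : C, is_heyting_algebra (P A)) /\
  (forall (A B : C) (f : Hom A B), is_heyting_hom (reindex (d := P) f)) /\
  is_full_universal.

(* Binary products are not chosen, so they are quantified over; m is the arrow
   id × {β} from X × Y to X × PX. *)
Definition has_weak_power_objects : Prop :=
  forall X : C,
  exists (PX W : C) (p : Hom W X) (q : Hom W PX) (mem : P W),
    is_product p q /\
    forall (Y V : C) (p' : Hom V X) (q' : Hom V Y), is_product p' q' ->
    forall b : P V,
    exists (c : Hom Y PX) (m : Hom V W),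
      (p ∘ m = p' /\ q ∘ m = c ∘ q') /\ b = reindex m mem.

Definition is_full_tripos : Prop :=
  has_finite_limits C /\ is_full_first_order_hyperdoctrine /\ has_weak_power_objects.

Record PointsOb := { pt_base : C; pt_elem : P pt_base }.

Definition PointsHom (a b : PointsOb) : Type :=
  { f : Hom (pt_base a) (pt_base b) | pt_elem a ⊑ reindex f (pt_elem b) }.

Lemma points_id_proof (a : PointsOb) :
  pt_elem a ⊑ reindex (idm (pt_base a)) (pt_elem a).
Proof. rewrite reindex_id; apply le_refl. Qed.

Lemma reindex_mono (A B : C) (f : Hom A B) (x y : P B) :
  x ⊑ y -> reindex f x ⊑ reindex f y.
Proof.
intros Hxy.
assert (E : x ⊓ y = x).
{ apply le_antisym.
  - exact (proj1 (proj1 (le_meet x y _) (le_refl _))).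
  - apply le_meet; split; [apply le_refl | exact Hxy]. }
rewrite <- E, reindex_meet.
exact (proj2 (proj1 (le_meet _ _ _) (le_refl _))).
Qed.

Lemma points_comp_proof (a b c : PointsOb) (g : PointsHom b c)
    (f : PointsHom a b) :
  pt_elem a ⊑ reindex (proj1_sig g ∘ proj1_sig f) (pt_elem c).
Proof.
rewrite reindex_comp.
apply (le_trans (proj2_sig f)), reindex_mono, (proj2_sig g).
Qed.

Definition points : Category.
Proof.
refine {| Ob := PointsOb; Hom := PointsHom;
          idm := fun a => exist _ (idm (pt_base a)) (points_id_proof a);
          comp := fun a b c g f =>
            exist _ (proj1_sig g ∘ proj1_sig f) (points_comp_proof g f) |};
  [ intros a b [f Hf] | intros a b [f Hf] | intros a b c d h g f ];
  apply subset_eq_compat; simpl.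
- apply comp_idl.
- apply comp_idr.
- apply comp_assoc.
Defined.

Definition is_ex_supercompactifiable : Prop :=
  has_finite_limits C /\
  has_weak_dependent_products points /\ has_generic_proof points.

End DoctrineProperties.

(* Main.v *)
(** The category of points of P/X is isomorphic to the slice of the category of
    points of P over (X, ⊤), so it suffices that weak dependent products and
    generic proofs pass to slices.  Weak dependent products are computed as in the
    base category, and a generic proof θ yields the generic proof θ × X.

    The slice hyperdoctrine structure is that of P, since pullbacks in C/X are
    pullbacks in C.  A weak power object of A → X is X × PA: an element β over
    A ×_X Y is the restriction along the mono i : A ×_X Y → A × Y of ∃_i β, which
    is classified by an arrow Y → PA. *)

From Stdlib Require Import FinFun List ProofIrrelevance.
Require Import Defs.
Import ListNotations.

Set Implicit Arguments.
Unset Strict Implicit.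
Unset Printing Implicit Defensive.

Local Open Scope cat_scope.

(** * Uniqueness for products and pullbacks; monomorphisms *)

Section UniversalProperties.
Variable C : Category.

Lemma product_hom_ext (A B W : C) (p : Hom W A) (q : Hom W B) :
  is_product p q -> forall (V : C) (m n : Hom V W),
  p ∘ m = p ∘ n -> q ∘ m = q ∘ n -> m = n.
Proof.
intros H V m n Hp Hq.
destruct (H V (p ∘ n) (q ∘ n)) as [r [_ Hr]].
rewrite <- (Hr m), <- (Hr n); auto.
Qed.

Lemma product_pair (A B W : C) (p : Hom W A) (q : Hom W B) :
  is_product p q -> forall (V : C) (a : Hom V A) (b : Hom V B),
  exists m : Hom V W, p ∘ m = a /\ q ∘ m = b.
Proof.
intros H V a b; destruct (H V a b) as [m [Hm _]]; now exists m.
Qed.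

Lemma pullback_hom_ext (A B I D : C) (f : Hom A I) (g : Hom B I)
    (p : Hom D A) (q : Hom D B) :
  is_pullback f g p q -> forall (V : C) (m n : Hom V D),
  p ∘ m = p ∘ n -> q ∘ m = q ∘ n -> m = n.
Proof.
intros [Hs H] V m n Hp Hq.
destruct (H V (p ∘ n) (q ∘ n)) as [r [_ Hr]].
{ now rewrite !comp_assoc, Hs. }
rewrite <- (Hr m), <- (Hr n); auto.
Qed.

Definition mono (A B : C) (i : Hom A B) : Prop :=
  forall (V : C) (m n : Hom V A), i ∘ m = i ∘ n -> m = n.

(** This square is the instance of Beck-Chevalley that makes [reindex i] undo existential
    quantification along a mono [i]. *)
Lemma mono_kernel_pair (A B : C) (i : Hom A B) :
  mono i -> is_pullback i i (idm A) (idm A).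
Proof.
intros Hi; split; [reflexivity|].
intros V a b E; apply Hi in E; subst b.
exists a; split.
- now rewrite comp_idl.
- intros m [<- _]; now rewrite comp_idl.
Qed.

End UniversalProperties.

(** * Binary products from finite limits *)

Section Products.

(** Arrows are equality proofs, so the category laws hold by proof irrelevance. *)
Definition discrete (T : Type) : Category.
Proof.
refine {| Ob := T; Hom := fun a b => a = b; idm := @eq_refl T;
          comp := fun a b c (g : b = c) (f : a = b) => eq_trans f g |};
  intros; apply proof_irrelevance.
Defined.

Definition discrete_functor (T : Type) (C : Category) (F : T -> C) :
  Functor (discrete T) C.
Proof.
refine {| fobj := F : discrete T -> C;
          fmap := fun (a b : discrete T) (u : Hom a b) =>
            match u in (_ = y) return Hom (F a) (F y) with
            | eq_refl => idm (F a)
            end |}.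
- reflexivity.
- intros a b c g f; destruct g, f; simpl; now rewrite comp_idl.
Defined.

Lemma finite_discrete_bool : finite_category (discrete bool).
Proof.
split.
- exists [true; false]; intros [|]; simpl; auto.
- intros a b.
  destruct (Bool.bool_dec a b) as [e|n].
  + exists [e]; intros e'; left; exact (proof_irrelevance (a = b) e e').
  + exists []; intros e; exact (n e).
Qed.

Lemma finite_limits_product (C : Category) : has_finite_limits C ->
  forall A B : C, exists (W : C) (p : Hom W A) (q : Hom W B), is_product p q.
Proof.
intros H A B.
set (F := discrete_functor (fun b : bool => if b then A else B)).
destruct (H _ finite_discrete_bool F) as [L [p [_ Hu]]].
exists L, (p true), (p false).
intros V a b.
destruct (Hu V (fun c : bool =>
    if c return Hom V (if c then A else B) then a else b)) as [m [Hm Hn]].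
{ intros c d u; destruct u, c; apply comp_idl. }
exists m; split.
- split; [exact (Hm true) | exact (Hm false)].
- intros n [Ha Hb]; apply Hn; intros [|]; assumption.
Qed.

End Products.

(** * Pullbacks, finite limits, weak dependent products and generic proofs in a slice *)

Section Slices.
Variables (C : Category) (X : C).

Lemma slice_hom_eq (f g : slice X) (h k : Hom f g) :
  proj1_sig h = proj1_sig k -> h = k.
Proof. destruct h, k; apply subset_eq_compat. Qed.

Definition over (A : C) (a : Hom A X) : slice X := Build_SliceOb a.

(** Taking the composite as structure map turns any arrow into [slice_dom A] into a slice arrow,
    with a trivial commutation proof. *)
Definition over_comp (A : slice X) (B : C) (h : Hom B (slice_dom A)) :
  Hom (over (slice_map A ∘ h)) A := exist _ h eq_refl.

Lemma slice_pullback (A B I D : slice X) (f : Hom A I) (g : Hom B I)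
    (p : Hom D A) (q : Hom D B) :
  is_pullback f g p q <->
  is_pullback (C := C) (proj1_sig f) (proj1_sig g) (proj1_sig p) (proj1_sig q).
Proof.
split; intros [Hs Hu]; split.
- exact (f_equal (@proj1_sig _ _) Hs).
- intros V a b E.
  (* The test object [V] gets its structure map through [A]; since [a] and [b] agree in [I], which
     lies over [X], the arrow [b] respects it too. *)
  assert (Hb : slice_map B ∘ b = slice_map A ∘ a).
  { rewrite <- (proj2_sig f), <- (proj2_sig g), <- !comp_assoc.
    now rewrite E. }
  destruct (Hu (over (slice_map A ∘ a)) (over_comp a) (exist _ b Hb))
    as [m [[Ha' Hb'] Hm]].
  { now apply slice_hom_eq. }
  exists (proj1_sig m); split.
  + split.
    * exact (f_equal (@proj1_sig _ _) Ha').
    * exact (f_equal (@proj1_sig _ _) Hb').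
  + intros n [Hna Hnb].
    assert (Hn : slice_map D ∘ n = slice_map A ∘ a).
    { now rewrite <- Hna, comp_assoc, (proj2_sig p). }
    assert (Em : m = exist _ n Hn).
    { apply Hm; split; now apply slice_hom_eq. }
    now rewrite Em.
- now apply slice_hom_eq.
- intros V a b E.
  destruct (Hu (slice_dom V) (proj1_sig a) (proj1_sig b)) as [m [[Ha Hb] Hm]].
  { exact (f_equal (@proj1_sig _ _) E). }
  (* The mediating arrow of the base lies over [X] because [p] and [a] do. *)
  assert (Hm' : slice_map D ∘ m = slice_map V).
  { now rewrite <- (proj2_sig p), <- comp_assoc, Ha, (proj2_sig a). }
  exists (exist _ m Hm'); split.
  + split; now apply slice_hom_eq.
  + intros n [<- <-]; apply slice_hom_eq; simpl; apply Hm; now split.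
Qed.

(** A pair of arrows that agree in [X] is the same as a span in the slice, with the common composite
    as structure map of its apex. *)
Lemma slice_product_pullback (A B W : slice X) (p : Hom W A) (q : Hom W B) :
  is_product p q ->
  is_pullback (C := C) (slice_map A) (slice_map B) (proj1_sig p) (proj1_sig q).
Proof.
intros Hu; split.
- now rewrite (proj2_sig p), (proj2_sig q).
- intros V a b E.
  destruct (Hu (over (slice_map A ∘ a)) (over_comp a)
              (exist _ b (eq_sym E))) as [m [[Ha' Hb'] Hm]].
  exists (proj1_sig m); split.
  + split.
    * exact (f_equal (@proj1_sig _ _) Ha').
    * exact (f_equal (@proj1_sig _ _) Hb').
  + intros n [Hna Hnb].
    assert (Hn : slice_map W ∘ n = slice_map A ∘ a).
    { now rewrite <- Hna, comp_assoc, (proj2_sig p). }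
    assert (Em : m = exist _ n Hn).
    { apply Hm; split; now apply slice_hom_eq. }
    now rewrite Em.
Qed.

(* A limit in C/X is a limit in C of the diagram enlarged by X and the structure
   maps to X, hence the finite index category with a terminal object added. *)
Section AdjoinTerminal.
Variable J : Category.

Definition terminal_hom (a b : option J) : Type :=
  match a, b with
  | Some a, Some b => Hom a b
  | _, None => unit
  | None, Some _ => Empty_set
  end.

Definition terminal_id (a : option J) : terminal_hom a a :=
  match a with Some a => idm a | None => tt end.

Definition terminal_comp (a b c : option J) :
  terminal_hom b c -> terminal_hom a b -> terminal_hom a c :=
  match a, b, c with
  | Some _, Some _, Some _ => fun g f => g ∘ f
  | Some _, None, Some _ => fun g _ => match g with end
  | None, Some _, Some _ => fun _ f => match f with end
  | None, None, Some _ => fun g _ => g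
  | _, _, None => fun _ _ => tt
  end.

Definition adjoin_terminal : Category.
Proof.
refine {| Ob := option J; Hom := terminal_hom; idm := terminal_id;
          comp := terminal_comp |}.
- intros [a|] [b|]; simpl; intros f; try destruct f; auto using comp_idl.
- intros [a|] [b|]; simpl; intros f; try destruct f; auto using comp_idr.
- intros [a|] [b|] [c|] [d|]; simpl; intros h g f;
    try destruct h; try destruct g; try destruct f; auto using comp_assoc.
Defined.

Lemma finite_adjoin_terminal :
  finite_category J -> finite_category adjoin_terminal.
Proof.
intros [[l Hl] Hh]; split.
- exists (None :: map Some l); intros [a|]; simpl; auto.
  right; apply in_map, Hl.
- intros [a|] [b|]; simpl.
  + apply Hh.
  + exists [tt]; intros []; simpl; auto.
  + exists []; intros [].
  + exists [tt]; intros []; simpl; auto.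
Qed.

Variable F : Functor J (slice X).

Definition base_obj (a : option J) : C :=
  match a with Some a => slice_dom (F a) | None => X end.

Definition base_map (a b : option J) :
  terminal_hom a b -> Hom (base_obj a) (base_obj b) :=
  match a, b with
  | Some a, Some b => fun u => proj1_sig (fmap F u)
  | Some a, None => fun _ => slice_map (F a)
  | None, Some _ => fun u => match u with end
  | None, None => fun _ => idm X
  end.

Definition base_diagram : Functor adjoin_terminal C.
Proof.
refine {| fobj := base_obj : adjoin_terminal -> C;
          fmap := base_map |}.
- intros [a|]; simpl; [now rewrite fmap_id | reflexivity].
- intros [a|] [b|] [c|]; simpl; intros g f; try destruct g; try destruct f;
    try (now rewrite fmap_comp); try (now rewrite comp_idl).
  (* The case left is an arrow of [J] followed by the arrow to the new terminal object: its image
     lies over [X]. *)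
  exact (eq_sym (proj2_sig (fmap F f))).
Defined.

End AdjoinTerminal.

Lemma slice_finite_limits : has_finite_limits C -> has_finite_limits (slice X).
Proof.
intros H J HJ F.
destruct (H _ (finite_adjoin_terminal HJ) (base_diagram F))
  as [L [p [Hc Hu]]].
assert (Hp : forall a, slice_map (F a) ∘ p (Some a) = p None).
{ intros a; exact (Hc (Some a) None tt). }
(* The leg at the adjoined terminal object serves as structure map of the limit; the other legs then
   lie over [X] by the cone condition. *)
exists (over (p None : Hom L X)).
exists (fun a => exist _ (p (Some a)) (Hp a) : Hom (over (p None : Hom L X)) (F a)).
split.
- intros a b u; apply slice_hom_eq; exact (Hc (Some a) (Some b) u).
- intros M q Hq.
  (* A cone in the slice becomes a cone on the enlarged diagram, its extra leg being the structure
     map of [M]. *)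
  destruct (Hu (slice_dom M) (fun a : option J =>
      match a return Hom (slice_dom M) (base_obj F a) with
      | Some a => proj1_sig (q a)
      | None => slice_map M
      end)) as [m [Hm Hn]].
  { intros [a|] [b|] u; simpl.
    - exact (f_equal (@proj1_sig _ _) (Hq a b u)).
    - exact (proj2_sig (q a)).
    - destruct u.
    - apply comp_idl. }
  exists (exist _ m (Hm None)); split.
  + intros a; apply slice_hom_eq; exact (Hm (Some a)).
  + intros n En; apply slice_hom_eq; simpl; apply Hn; intros [a|].
    * exact (f_equal (@proj1_sig _ _) (En a)).
    * exact (proj2_sig n).
Qed.

(** The data found in the base acquire structure maps by composing with those of [I] and [J]. Every
    comparison arrow [w] or [k] then lies over [X] because it commutes with arrows that do. *)
Lemma slice_weak_dependent_products :
  has_weak_dependent_products C -> has_weak_dependent_products (slice X).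
Proof.
intros H F J I f g.
destruct (H _ _ _ (proj1_sig f) (proj1_sig g))
  as [Z [E [h [p [q [e [[Hpb He] Hw]]]]]]].
assert (Hq : (slice_map I ∘ h) ∘ q = slice_map J ∘ p).
{ rewrite <- comp_assoc, <- (proj1 Hpb), comp_assoc; f_equal.
  apply (proj2_sig g). }
assert (He' : slice_map F ∘ e = slice_map J ∘ p).
{ now rewrite <- He, comp_assoc, (proj2_sig f). }
exists (over (slice_map I ∘ h)), (over (slice_map J ∘ p)).
exists (over_comp h), (over_comp p), (exist _ q Hq), (exist _ e He').
split.
- split; [now apply slice_pullback | now apply slice_hom_eq].
- intros Z' E' h' p' q' e' [Hpb' Ee].
  destruct (Hw _ _ (proj1_sig h') (proj1_sig p') (proj1_sig q') (proj1_sig e'))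
    as [w [Eh [k [[Ep Eq] Ek]]]].
  { split; [now apply slice_pullback in Hpb'|].
    exact (f_equal (@proj1_sig _ _) Ee). }
  assert (Sw : (slice_map I ∘ h) ∘ w = slice_map Z').
  { now rewrite <- comp_assoc, <- Eh, (proj2_sig h'). }
  assert (Sk : (slice_map J ∘ p) ∘ k = slice_map E').
  { now rewrite <- comp_assoc, Ep, (proj2_sig p'). }
  exists (exist _ w Sw); split; [now apply slice_hom_eq|].
  exists (exist _ k Sk).
  split; [split|]; now apply slice_hom_eq.
Qed.

(** An arrow into θ × X's codomain that lies over [X] amounts to its first component [u], and
    pulling θ × X back along it gives the same object as pulling θ back along [u]. The
    factorizations in the base are automatically over [X]. *)
Lemma slice_generic_proof :
  (forall A : C, exists (W : C) (p : Hom W A) (q : Hom W X), is_product p q) ->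
  has_generic_proof C -> has_generic_proof (slice X).
Proof.
intros Hprod [T [L [theta Hg]]].
destruct (Hprod T) as [TX [t1 [t2 HT]]].
destruct (Hprod L) as [LX [l1 [l2 HL]]].
destruct (product_pair HL (theta ∘ t1) t2) as [thX [Et1 Et2]].
exists (over t2), (over l2), (exist _ thX Et2).
intros Y A f.
destruct (Hg _ _ (proj1_sig f)) as [u [W [p [q [[Hs Hu] [[r Hr] [s Hps]]]]]]].
(* The second components of [uX] and [qX] are forced by the requirement to lie over [X]. *)
destruct (product_pair HL u (slice_map A)) as [uX [Eu1 Eu2]].
destruct (product_pair HT q (slice_map A ∘ p)) as [qX [Eq1 Eq2]].
exists (exist _ uX Eu2), (over (slice_map A ∘ p)), (over_comp p).
exists (exist _ qX Eq2).
split; [|split].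
- apply slice_pullback; simpl; split.
  + apply (product_hom_ext HL); rewrite !comp_assoc.
    * now rewrite Eu1, Et1, <- comp_assoc, Eq1.
    * now rewrite Eu2, Et2.
  + intros V a b E.
    (* The first component of [E] gives a cone on the pullback of [theta] along [u]; the second
       determines the [X]-component of [b]. *)
    assert (E1 : u ∘ a = theta ∘ (t1 ∘ b)).
    { rewrite comp_assoc, <- Eu1, <- Et1, <- !comp_assoc; now rewrite E. }
    assert (E2 : slice_map A ∘ a = t2 ∘ b).
    { rewrite <- Eu2, <- Et2, <- !comp_assoc; now rewrite E. }
    destruct (Hu V a (t1 ∘ b) E1) as [m [[Hma Hmb] Hm]].
    exists m; split.
    * split; [assumption|].
      apply (product_hom_ext HT); rewrite comp_assoc.
      -- now rewrite Eq1.
      -- now rewrite Eq2, <- comp_assoc, Hma.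
    * intros n [<- <-]; apply Hm; split; [reflexivity|].
      now rewrite comp_assoc, Eq1.
- assert (Sr : (slice_map A ∘ p) ∘ r = slice_map Y).
  { now rewrite <- comp_assoc, <- Hr, (proj2_sig f). }
  exists (exist _ r Sr); now apply slice_hom_eq.
- assert (Ss : slice_map Y ∘ s = slice_map A ∘ p).
  { now rewrite Hps, comp_assoc, (proj2_sig f). }
  exists (exist _ s Ss); now apply slice_hom_eq.
Qed.

End Slices.

(** * Transfer along a fully faithful functor that is surjective on objects up to equality *)

Section Equivalence.
Variables (D E : Category) (F : Functor D E).
Hypothesis full : forall (a b : D) (h : Hom (F a) (F b)), exists k, fmap F k = h.
Hypothesis faithful : forall (a b : D) (h k : Hom a b),
  fmap F h = fmap F k -> h = k.
Hypothesis surjective : forall e : E, exists d : D, F d = e.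

Lemma equivalence_pullback (A B I W : D) (f : Hom A I) (g : Hom B I)
    (p : Hom W A) (q : Hom W B) :
  is_pullback f g p q <->
  is_pullback (fmap F f) (fmap F g) (fmap F p) (fmap F q).
Proof.
split; intros [Hs Hu]; split.
- now rewrite <- !fmap_comp, Hs.
- intros V' a' b' E'.
  (* Surjectivity is an equality of objects, so a test object can be replaced by an image and its
     arrows lifted by fullness, without transport along isomorphisms. *)
  destruct (surjective V') as [V <-].
  destruct (full a') as [a <-], (full b') as [b <-].
  rewrite <- !fmap_comp in E'; apply faithful in E'.
  destruct (Hu V a b E') as [m [[<- <-] Hm]].
  exists (fmap F m); split.
  + now rewrite !fmap_comp.
  + intros n' [Ha Hb]; destruct (full n') as [n <-].
    rewrite <- !fmap_comp in Ha, Hb.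
    f_equal; apply Hm; split; now apply faithful.
- apply faithful; now rewrite !fmap_comp.
- intros V a b E'.
  destruct (Hu (F V) (fmap F a) (fmap F b)) as [m' [[Ha Hb] Hm]].
  { now rewrite <- !fmap_comp, E'. }
  destruct (full m') as [m <-].
  rewrite <- !fmap_comp in Ha, Hb; apply faithful in Ha, Hb.
  exists m; split; [now split|].
  intros n [<- <-]; apply faithful, Hm; now rewrite !fmap_comp.
Qed.

Lemma equivalence_weak_dependent_products :
  has_weak_dependent_products E -> has_weak_dependent_products D.
Proof.
intros H X J I f g.
destruct (H _ _ _ (fmap F f) (fmap F g))
  as [Z' [E' [h' [p' [q' [e' [[Hpb He] Hw]]]]]]].
destruct (surjective Z') as [Z <-], (surjective E') as [E0 <-].
destruct (full h') as [h <-], (full p') as [p <-].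
destruct (full q') as [q <-], (full e') as [e <-].
exists Z, E0, h, p, q, e; split.
- split; [now apply equivalence_pullback|].
  apply faithful; now rewrite fmap_comp.
- intros Z1 E1 h1 p1 q1 e1 [Hpb1 He1].
  destruct (Hw _ _ (fmap F h1) (fmap F p1) (fmap F q1) (fmap F e1))
    as [w' [Eh [k' [[Ep Eq] Ee]]]].
  { split; [now apply equivalence_pullback|]; now rewrite <- fmap_comp, He1. }
  destruct (full w') as [w <-], (full k') as [k <-].
  rewrite <- fmap_comp in Eh, Ep, Ee; rewrite <- !fmap_comp in Eq.
  apply faithful in Eh, Ep, Eq, Ee.
  exists w; split; [assumption|]; exists k; auto.
Qed.

Lemma equivalence_generic_proof : has_generic_proof E -> has_generic_proof D.
Proof.
intros [T' [L' [theta' H]]].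
destruct (surjective T') as [T <-], (surjective L') as [L <-].
destruct (full theta') as [theta <-].
exists T, L, theta; intros Y X f.
destruct (H _ _ (fmap F f)) as [u' [W' [p' [q' [Hpb [[r' Hr] [s' Hs]]]]]]].
destruct (surjective W') as [W <-].
destruct (full u') as [u <-], (full p') as [p <-], (full q') as [q <-].
destruct (full r') as [r <-], (full s') as [s <-].
rewrite <- fmap_comp in Hr, Hs; apply faithful in Hr, Hs.
exists u, W, p, q; split; [now apply equivalence_pullback|].
split; [now exists r | now exists s].
Qed.

End Equivalence.

(** * Points of the slice doctrine as a slice of the category of points *)

Section Points.
Variables (C : Category) (P : Doctrine C) (X : C).

Lemma points_hom_eq (Q : Doctrine C) (a b : points Q) (f g : Hom a b) :
  proj1_sig f = proj1_sig g -> f = g.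
Proof. destruct f, g; apply subset_eq_compat. Qed.

Definition top_point (A : C) : points P := @Build_PointsOb C P A top.

Definition to_top_point (a : points P) (A : C) (f : Hom (pt_base a) A) :
  Hom a (top_point A).
Proof.
exists f; simpl; rewrite reindex_top; apply le_top.
Defined.

(** The factor with element ⊤ imposes no condition, so the element of the product is [alpha]
    reindexed along the first projection. *)
Lemma points_top_product : has_finite_limits C -> forall A : points P,
  exists (W : points P) (p : Hom W A) (q : Hom W (top_point X)), is_product p q.
Proof.
intros HC [A alpha].
destruct (finite_limits_product HC A X) as [W [p [q Hpq]]].
exists (@Build_PointsOb C P W (reindex p alpha)).
exists (exist _ p (le_refl _)), (@to_top_point (Build_PointsOb _) X q).
intros V a b.
destruct (Hpq _ (proj1_sig a) (proj1_sig b)) as [m [[Ea Eb] Hm]].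
assert (Hle : pt_elem V ⊑ reindex m (reindex p alpha)).
{ rewrite <- reindex_comp, Ea; exact (proj2_sig a). }
exists (exist _ m Hle); split.
- split; now apply points_hom_eq.
- intros n [<- <-]; apply points_hom_eq; simpl; apply Hm; now split.
Qed.

(** On both sides an arrow is a base arrow with an inequality and a commutation over [X]; the
    functor only exchanges the nesting of the two proofs. *)
Definition slice_points : Functor (points (slice_doctrine P X)) (slice (top_point X)).
Proof.
refine {| fobj := fun d : points (slice_doctrine P X) =>
            over (@to_top_point (@Build_PointsOb C P (slice_dom (pt_base d)) (pt_elem d))
                    X (slice_map (pt_base d)));
          fmap := fun (d d' : points (slice_doctrine P X)) (h : Hom d d') =>
            exist _ (exist _ (proj1_sig (proj1_sig h)) (proj2_sig h)) _ |}.
Unshelve.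
- intros d; now apply slice_hom_eq, points_hom_eq.
- intros a b c g f; now apply slice_hom_eq, points_hom_eq.
- apply points_hom_eq; exact (proj2_sig (proj1_sig h)).
Defined.

Lemma slice_points_full (a b : points (slice_doctrine P X))
    (h : Hom (slice_points a) (slice_points b)) :
  exists k, fmap slice_points k = h.
Proof.
exists (exist _ (exist _ (proj1_sig (proj1_sig h))
                   (f_equal (@proj1_sig _ _) (proj2_sig h)))
          (proj2_sig (proj1_sig h))).
now apply slice_hom_eq, points_hom_eq.
Qed.

Lemma slice_points_faithful (a b : points (slice_doctrine P X)) (h k : Hom a b) :
  fmap slice_points h = fmap slice_points k -> h = k.
Proof.
intros E.
apply (f_equal (@proj1_sig _ _)), (f_equal (@proj1_sig _ _)) in E; simpl in E.
destruct h as [h Hh], k as [k Hk]; apply subset_eq_compat.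
now apply slice_hom_eq.
Qed.

Lemma slice_points_surjective (e : slice (top_point X)) :
  exists d, slice_points d = e.
Proof.
destruct e as [[A alpha] a]; simpl in *.
exists (@Build_PointsOb _ (slice_doctrine P X) (over (proj1_sig a)) alpha).
simpl; unfold over; f_equal.
(* The rebuilt structure map differs from the given one only in its proof of the inequality. *)
now apply points_hom_eq.
Qed.

Lemma slice_ex_supercompactifiable :
  is_ex_supercompactifiable P -> is_ex_supercompactifiable (slice_doctrine P X).
Proof.
intros [HC [Hw Hg]]; split; [|split].
- now apply slice_finite_limits.
- apply (equivalence_weak_dependent_products slice_points_full
           slice_points_faithful slice_points_surjective).
  now apply slice_weak_dependent_products.
- apply (equivalence_generic_proof slice_points_full
           slice_points_faithful slice_points_surjective).
  apply slice_generic_proof; [|assumption].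
  now apply points_top_product.
Qed.

End Points.

(** * Tripos structure on the slice doctrine *)

Section SliceTripos.
Variables (C : Category) (P : Doctrine C) (X : C).

(** Beck-Chevalley for the kernel pair of [i] reduces the left side to ∃ along an identity, which is
    trivial by adjointness. *)
Lemma reindex_exists_mono (ex : forall A B : C, Hom A B -> P A -> P B) :
  (forall A B (f : Hom A B), is_left_adjoint f (ex A B f)) ->
  beck_chevalley ex ->
  forall (A B : C) (i : Hom A B), mono i ->
  forall x : P A, reindex i (ex A B i x) = x.
Proof.
intros Hadj HBC A B i Hi x.
rewrite (HBC _ _ _ _ _ _ _ _ (mono_kernel_pair Hi)), reindex_id.
apply le_antisym.
- apply Hadj; rewrite reindex_id; apply le_refl.
- rewrite <- (reindex_id (ex _ _ _ _)); apply Hadj, le_refl.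
Qed.

Lemma slice_full_first_order_hyperdoctrine :
  is_full_first_order_hyperdoctrine P ->
  is_full_first_order_hyperdoctrine (slice_doctrine P X).
Proof.
intros [[ex [Hex [BCex Fr]]] [HH [Hhom [all [Hall BCall]]]]].
split; [|split; [|split]].
- exists (fun A B f => ex (slice_dom A) (slice_dom B) (proj1_sig f)).
  split; [|split].
  + intros A B f; apply Hex.
  + intros A B I D f g p q Hpb; apply BCex; now apply slice_pullback.
  + intros A B f; apply Fr.
- intros A; apply HH.
- intros A B f; apply Hhom.
- exists (fun A B f => all (slice_dom A) (slice_dom B) (proj1_sig f)).
  split.
  + intros A B f; apply Hall.
  + intros A B I D f g p q Hpb; apply BCall; now apply slice_pullback.
Qed.

Lemma slice_weak_power_objects :
  has_finite_limits C -> is_full_existential P -> has_weak_power_objects P ->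
  has_weak_power_objects (slice_doctrine P X).
Proof.
intros HC [ex [Hex [BC _]]] HP A.
destruct (HP (slice_dom A)) as [PA [W [p [q [mem [Hpq Hmem]]]]]].
destruct (finite_limits_product HC X PA) as [XP [x1 [x2 Hx]]].
(* The slice product of [A] and X × PA is A × PA, that is [W]: the [X]-component is already
   determined by [A]. So [mem] can be kept as membership element. *)
destruct (product_pair Hx (slice_map A ∘ p) q) as [r [Er1 Er2]].
exists (over x1), (over (slice_map A ∘ p)), (over_comp p), (exist _ r Er1), mem.
split.
- intros V a b.
  destruct (product_pair Hpq (proj1_sig a) (x2 ∘ proj1_sig b)) as [m [Em1 Em2]].
  assert (Sm : (slice_map A ∘ p) ∘ m = slice_map V).
  { now rewrite <- comp_assoc, Em1, (proj2_sig a). }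
  exists (exist _ m Sm); split.
  + split; apply slice_hom_eq; simpl; [assumption|].
    apply (product_hom_ext Hx); rewrite comp_assoc.
    * rewrite Er1, Sm; exact (eq_sym (proj2_sig b)).
    * now rewrite Er2.
  + intros n [<- <-]; apply slice_hom_eq; simpl in *.
    apply (product_hom_ext Hpq); [assumption|].
    now rewrite Em2, comp_assoc, Er2.
- intros Y V p' q' Hpq' beta.
  destruct (finite_limits_product HC (slice_dom A) (slice_dom Y))
    as [AY [a1 [a2 HAY]]].
  destruct (product_pair HAY (proj1_sig p') (proj1_sig q')) as [i [Ei1 Ei2]].
  (* The arrow [i] compares the product over [X] with the one in the base; it is mono since the
     pullback projections are jointly monic. *)
  assert (Hi : mono i).
  { intros U m n E.
    apply (pullback_hom_ext (slice_product_pullback Hpq'));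
      rewrite <- ?Ei1, <- ?Ei2, <- !comp_assoc; now rewrite E. }
  destruct (Hmem _ _ _ _ HAY (ex _ _ i beta)) as [c [m [[Em1 Em2] Hbeta]]].
  (* Pairing [c] with the structure map of [Y] makes it an arrow over [X]; the arrow id × {β} of the
     slice is then [m] restricted along [i]. *)
  destruct (product_pair Hx (slice_map Y) c) as [cX [Ec1 Ec2]].
  assert (Sm : (slice_map A ∘ p) ∘ (m ∘ i) = slice_map V).
  { rewrite <- (proj2_sig p'), <- Ei1, <- Em1, <- !comp_assoc; reflexivity. }
  exists (exist _ cX Ec1), (exist _ (m ∘ i) Sm).
  split; [split|].
  + apply slice_hom_eq; simpl; now rewrite comp_assoc, Em1.
  + apply slice_hom_eq; simpl.
    apply (product_hom_ext Hx); rewrite comp_assoc.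
    * rewrite Er1, Sm, comp_assoc, Ec1; exact (eq_sym (proj2_sig q')).
    * rewrite Er2, !comp_assoc, Em2, Ec2, <- comp_assoc; now rewrite Ei2.
  + simpl; rewrite reindex_comp, <- Hbeta.
    symmetry; exact (reindex_exists_mono Hex BC Hi beta).
Qed.

Lemma slice_full_tripos :
  is_full_tripos P -> is_full_tripos (slice_doctrine P X).
Proof.
intros [HC [HF HP]]; split; [|split].
- now apply slice_finite_limits.
- now apply slice_full_first_order_hyperdoctrine.
- apply slice_weak_power_objects; [assumption | apply HF | assumption].
Qed.

End SliceTripos.

Theorem corollary7p15 (C : Category) (P : Doctrine C)
    (hT : is_full_tripos P) (hS : is_ex_supercompactifiable P) (X : C) :
  is_full_tripos (slice_doctrine P X) /\
  is_ex_supercompactifiable (slice_doctrine P X).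
Proof.
split; [now apply slice_full_tripos | now apply slice_ex_supercompactifiable].
Qed.
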